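(* Let $\{J,J'\}$ be a good system in $\Phi$, and let $U$ be a $K\mathcal{W}$-submodule of $M^{\Delta}$. Then either $S^{\Delta,\Delta'}\subseteq U$ or $U\subseteq (S^{\Delta,\Delta'})^{\perp}$, where $(S^{\Delta,\Delta'})^{\perp}$ is the orthogonal complement of $S^{\Delta,\Delta'}$ in $M^{\Delta}$ with respect to the bilinear form $\langle\,,\rangle$.
   Context: Root systems: $\Phi$ is a root system (finite, reduced, crystallographic) in a finite-dimensional real Euclidean space $V$, with simple system $\pi$ and corresponding positive system $\Phi^{+}$; $\mathcal{W}$ is its Weyl group, generated by the reflections $\tau_\alpha$ ($\alpha\in\Phi$). $l(w)$ is the length of $w$ with respect to $\pi$ and $s(w)=(-1)^{l(w)}$. A subsystem of $\Phi$ is a subset which is itself a root system in the space it spans (the empty set is allowed). A subsystem $\Psi$ is additively closed if $\alpha,\beta\in\Psi$ and $\alpha+\beta\in\Phi$ imply $\alpha+\beta\in\Psi$. Useful systems: $\Psi$ is an additively closed subsystem of $\Phi$ with simple system $J\subset\Phi^{+}$, and $\Psi'$ is a subsystem with $\Psi'\subseteq\Phi\setminus\Psi$ and simple system $J'\subset\Phi^{+}$. $\mathcal{W}(J)$ is the subgroup generated by $\tau_\alpha$, $\alpha\in\Psi$; similarly $\mathcal{W}(J')$, and $\mathcal{W}(wJ)=w\mathcal{W}(J)w^{-1}$, $\mathcal{W}(wJ')=w\mathcal{W}(J')w^{-1}$ for $w\in\mathcal{W}$. $\Psi^{\perp}$ (resp. $\Psi'^{\perp}$) is the largest subsystem of $\Phi$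 orthogonal to $\Psi$ (resp. $\Psi'$), with simple system $J^{\perp}\subset\Phi^+$ (resp. $J'^{\perp}\subset\Phi^+$), and $\mathcal{W}(J^\perp)$, $\mathcal{W}(J'^\perp)$ are the corresponding reflection subgroups. $\{J,J'\}$ is a useful system if $\mathcal{W}(J)\cap\mathcal{W}(J')=\langle e\rangle$ and $\mathcal{W}(J^{\perp})\cap\mathcal{W}(J'^{\perp})=\langle e\rangle$. Tableaux and tabloids: fix orderings of the elements of $J$ and of $J'$ and let $\bar J$ be the resulting ordered tuple of roots (elements of $J$, then of $J'$). The $\Delta$-tableaux are the $w\bar J$, $w\in\mathcal{W}$. Two $\Delta$-tableaux $w_1\bar J$, $w_2\bar J$ are row-equivalent if $w_2\bar J=\rho w_1\bar J$ for some $\rho\in\mathcal{W}(w_1J)$. The equivalence class of $w\bar J$ is the $\Delta$-tabloid $\{w\bar J\}$. $\mathcal{W}$ acts on tabloids by $\sigma\{w\bar J\}=\{\sigma w\bar J\}$. Modules: $K$ is an arbitrary field; $M^{\Delta}$ is the $K$-space with basis the $\Delta$-tabloids, a $K\mathcal{W}$-module by linear extension. $\kappa_{J'}=\sum_{\sigma\in\mathcal{W}(J')}s(\sigma)\sigma$, $e_{J,J'}=\kappa_{J'}\{\bar J\}$, and for $w\in\mathcal{W}$, $e_{wJ,wJ'}=\kappa_{wJ'}\{w\bar J\}=w\,e_{J,J'}$. The generalized Specht module $S^{\Delta,\Delta'}$ is the $K$-subspace of $M^\Delta$ spanned by all $e_{wJ,wJ'}$, $w\in\mathcal{W}$. Good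 systems: $D_{\Psi}=\{w\in\mathcal{W}: w(j)\in\Phi^{+}\text{ for all }j\in J\}$. A useful system $\{J,J'\}$ is a good system if for every $d\in D_\Psi$ with $d\Psi\cap\Psi'=\emptyset$, the tabloid $\{d\bar J\}$ appears with non-zero coefficient in $e_{J,J'}$. Form: $\langle\,,\rangle$ is the bilinear form on $M^\Delta$ for which $\langle t_1,t_2\rangle=1$ if $t_1=t_2$ and $0$ otherwise, for $\Delta$-tabloids $t_1,t_2$. *)

(* Defs.v *)
From HB Require Import structures.
From mathcomp Require Import all_boot all_order all_algebra all_fingroup.
From mathcomp Require Import sesquilinear finmap boolp reals.

Set Implicit Arguments.
Unset Strict Implicit.
Unset Printing Implicit Defensive.

Import Order.TTheory GRing.Theory Num.Theory.

Local Open Scope ring_scope.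

Section RootSystems.
Variables (R : realType) (V : vectType R) (dot : {dot V for idfun}).

Definition cartan (a v : V) : R := 2 * dot v a / dot a a.

Definition reflection (a v : V) : V := v - cartan a v *: a.

(* No spanning condition: A is a root system in the space it spans. *)
Definition is_root_system (A : {fset V}) : Prop :=
  [/\ 0 \notin A,
      {in A &, forall a b, reflection a b \in A},
      {in A &, forall a b, cartan a b \is a Num.int}
    & {in A, forall a (c : R), c *: a \in A -> c = 1 \/ c = -1}].

Record rootSystem := RootSystem {
  roots :> {fset V};
  rootsP : is_root_system roots }.

Lemma dotC (u v : V) : dot u v = dot v u.
Proof. by rewrite (hermitian_subproof u v) expr0 mul1r. Qed.

Lemma dot_neq0 (a : V) : a != 0 -> dot a a != 0.
Proof. by move=> a0; rewrite gt_eqF ?neq0_dnorm_gt0. Qed.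

Lemma cartanB (a u v : V) : cartan a (u - v) = cartan a u - cartan a v.
Proof. by rewrite /cartan linearBl/= mulrBr mulrBl. Qed.

Lemma cartanZ (a v : V) c : cartan a (c *: v) = c * cartan a v.
Proof. by rewrite /cartan linearZl_LR/= mulrCA !mulrA. Qed.

Lemma cartan_id (a : V) : a != 0 -> cartan a a = 2.
Proof. by move=> a0; rewrite /cartan mulfK ?dot_neq0. Qed.

Lemma reflectionB (a u v : V) :
  reflection a (u - v) = reflection a u - reflection a v.
Proof.
rewrite /reflection cartanB scalerBl !opprB addrACA [RHS]addrACA.
by congr (_ + _); rewrite addrC.
Qed.

Lemma reflectionK (a : V) : a != 0 -> involutive (reflection a).
Proof.
move=> a0 v; rewrite {1}/reflection {1}/reflection cartanB cartanZ cartan_id//.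
by rewrite mulr_natr mulr2n opprD addrA subrr add0r scaleNr opprK /reflection subrK.
Qed.

Lemma dot_reflection (a u v : V) : a != 0 ->
  dot (reflection a u) v = dot u (reflection a v).
Proof.
move=> a0; rewrite /reflection linearBl/= linearBr/= linearZl_LR/= linearZr/=.
rewrite /cartan [dot v a]dotC. congr (_ - _).
by rewrite -!mulrA; congr (_ * _); rewrite mulrC [RHS]mulrC mulrAC.
Qed.

Section WeylGroup.
Variable Phi : rootSystem.

Lemma root_neq0 (a : Phi) : val a != 0.
Proof.
by apply/eqP => a0; case: (rootsP Phi); rewrite -a0 (valP a).
Qed.

Lemma reflection_root (a b : Phi) : reflection (val a) (val b) \in roots Phi.
Proof. by case: (rootsP Phi) => _ + _ _; apply; exact: valP. Qed.

Definition tau_fun (a b : Phi) : Phi := [` reflection_root a b]%fset.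

Lemma tau_fun_inj (a : Phi) : injective (tau_fun a).
Proof.
move=> b c /(congr1 val)/= e; apply/val_inj.
by rewrite -(reflectionK (root_neq0 a) (val b)) e reflectionK ?root_neq0.
Qed.

Definition tau_perm (a : Phi) : {perm Phi} := perm (@tau_fun_inj a).

(* A composite of reflections is determined by its restriction to Phi, so the *)
(* Weyl group is represented below as a group of permutations of Phi.         *)
Lemma reflections_faithful (s t : seq Phi) :
    let act (r : seq Phi) v := foldr (fun a => reflection (val a)) v r in
    (forall b : Phi, act s (val b) = act t (val b)) ->
  forall v, act s v = act t v.
Proof.
move=> act st v; apply/eqP; rewrite -subr_eq0; set d := _ - _.
have actV r u : act (rev r) (act r u) = u.
  rewrite /act; elim: r u => //= a r IH u.
  by rewrite rev_cons foldr_rcons reflectionK ?root_neq0.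
have dot_act r u u' : dot (act r u) (act r u') = dot u u'.
  elim: r => //= a r IH.
  by rewrite dot_reflection ?root_neq0// reflectionK ?root_neq0.
have act_root r (b : Phi) : act r (val b) \in roots Phi.
  elim: r => [|a r IH] /=; first exact: valP.
  exact: (reflection_root a [` IH]%fset).
have dperp (b : Phi) : dot d (val b) = 0.
  have [c cb] : exists c : Phi, act s (val c) = val b.
    exists [` act_root (rev s) b]%fset => /=.
    by have := actV (rev s) (val b); rewrite revK.
  by rewrite /d linearBl/= -cb dot_act st dot_act subrr.
have act_sub r : dot d (act r v - v) = 0.
  elim: r => [|a r IH] /=; first by rewrite subrr linear0r.
  rewrite /reflection addrAC linearBr/= IH sub0r linearZr/= dperp mulr0.
  by rewrite oppr0.
have /eqP := act_sub s; have /eqP := act_sub t.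
rewrite !linearBr/= !subr_eq0 => /eqP dt /eqP ds.
apply/negPn/negP; rewrite -subr_eq0 -/d => d0.
have : 0 < dot d d by rewrite neq0_dnorm_gt0.
by rewrite {2}/d linearBr/= ds dt subrr ltxx.
Qed.

Definition weyl_group : {group {perm Phi}} := <<[set tau_perm a | a : Phi]>>%G.

Definition weyl : finGroupType := [subg weyl_group].

(* Products in {perm _} compose left to right, so (v * w) a is w (v a). *)
Definition wact (w : weyl) (a : Phi) : Phi := sgval w a.

Lemma tau_weyl_group (a : Phi) : tau_perm a \in weyl_group.
Proof. by rewrite mem_gen ?imset_f. Qed.

Definition tau (a : Phi) : weyl := subg weyl_group (tau_perm a).

Lemma wact_tau (a b : Phi) : val (wact (tau a) b) = reflection (val a) (val b).
Proof. by rewrite /wact subgK ?tau_weyl_group// permE. Qed.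

Lemma wactM (v w : weyl) (a : Phi) : wact (v * w)%g a = wact w (wact v a).
Proof. by rewrite /wact /= permM. Qed.

(* For a subsystem Psi with simple system J, this is W(J). *)
Definition refl_group (Psi : {set Phi}) : {group weyl} :=
  <<[set tau a | a in Psi]>>%G.

Definition subsystem (Psi : {set Phi}) : Prop :=
  is_root_system [fset val a | a in Psi]%fset.

Definition additively_closed (Psi : {set Phi}) : Prop :=
  {in Psi &, forall a b, forall c : Phi, val a + val b = val c -> c \in Psi}.

Definition nonneg_comb (B : seq Phi) (v : V) : Prop :=
  exists2 c : Phi -> R, {in B, forall b, 0 <= c b} &
                        v = \sum_(b <- B) c b *: val b.

Definition simple_system (Psi : {set Phi}) (B : seq Phi) : Prop :=
  [/\ {subset B <= Psi},
      free [seq val b | b <- B]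
    & {in Psi, forall a, nonneg_comb B (val a) \/ nonneg_comb B (- val a)}].

Definition positive_system (pi : seq Phi) : {set Phi} :=
  [set a | `[< nonneg_comb pi (val a) >]].

Definition perp (Psi : {set Phi}) : {set Phi} :=
  [set a : Phi | [forall b in Psi, dot (val a) (val b) == 0]].

Lemma subsystemP (Psi : {set Phi}) :
  {in Psi &, forall a b, wact (tau a) b \in Psi} <-> subsystem Psi.
Proof.
have memP (b : Phi) : (val b \in [fset val a | a in Psi]%fset) = (b \in Psi).
  apply/imfsetP/idP => [[c cP /val_inj ->]//|bP]; by exists b.
split=> [closed|[_ closed _ _] a b aP bP]; last first.
  by rewrite -memP wact_tau closed// memP.
have [R0 Rrefl Rint Rred] := rootsP Phi.
split.
- by apply/imfsetP => -[a _ a0]; case/eqP: (root_neq0 a).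
- move=> _ _ /imfsetP[a aP ->] /imfsetP[b bP ->].
  by rewrite -wact_tau memP closed.
- by move=> _ _ /imfsetP[a aP ->] /imfsetP[b bP ->]; apply: Rint; apply: valP.
- move=> _ /imfsetP[a aP ->] c /imfsetP[b bP] cab.
  by apply: (Rred (val a)); rewrite ?cab; apply: valP.
Qed.

Lemma perp_largest (Psi : {set Phi}) :
  [/\ subsystem (perp Psi),
      {in perp Psi & Psi, forall a b, dot (val a) (val b) = 0}
    & forall Theta : {set Phi}, subsystem Theta ->
        {in Theta & Psi, forall a b, dot (val a) (val b) = 0} ->
      Theta \subset perp Psi].
Proof.
have perpP (a : Phi) :
    reflect {in Psi, forall b, dot (val a) (val b) = 0} (a \in perp Psi).
  by rewrite inE; apply: (iffP forall_inP) => h b /h /eqP.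
split=> [|a b /perpP h /h //|Theta _ h]; last first.
  by apply/subsetP => a aT; apply/perpP => b; apply: h.
apply/subsystemP => a b /perpP ha /perpP hb; apply/perpP => c cP.
rewrite wact_tau /reflection linearBl/= linearZl_LR/= ha// hb//.
by rewrite mulr0 subrr.
Qed.

Section Length.
Variable pi : seq Phi.

(* S ^+ k is the set of products of k elements of S. The default value 0 is   *)
(* never used when pi is a simple system of Phi, since S then generates weyl. *)
Definition length (w : weyl) : nat :=
  let S := [set tau a | a in pi] in
  if pselect (exists k, w \in (S ^+ k)%g) is left wS then ex_minn wS else 0%N.

Definition sign (K : fieldType) (w : weyl) : K := (-1) ^+ length w.

End Length.

Record useful_system (pi : seq Phi) (Psi : {set Phi}) (J : seq Phi)
    (Psi' : {set Phi}) (J' : seq Phi) : Prop := UsefulSystem {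
  useful_subsystem : subsystem Psi;
  useful_closed : additively_closed Psi;
  useful_simple : simple_system Psi J;
  useful_positive : {subset J <= positive_system pi};
  useful_subsystem' : subsystem Psi';
  useful_disjoint : Psi' \subset ~: Psi;
  useful_simple' : simple_system Psi' J';
  useful_positive' : {subset J' <= positive_system pi};
  useful_cap : refl_group Psi :&: refl_group Psi' = 1%g;
  useful_cap_perp : refl_group (perp Psi) :&: refl_group (perp Psi') = 1%g }.

Section Tabloids.
Variables (pi : seq Phi) (Psi : {set Phi}) (J : seq Phi).
Variables (Psi' : {set Phi}) (J' : seq Phi).

(* With Theta = Psi (resp. Psi') this is W(wJ) = w W(J) w^-1 (resp. W(wJ')):   *)
(* Theta :^ w is w^-1 * Theta * w for the left-to-right product.               *)
Definition conj_refl_group (Theta : {set Phi}) (w : weyl) : {group weyl} :=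
  (refl_group Theta :^ w)%G.

Definition tuples := (size J + size J').-tuple Phi.

Definition Jbar : tuples := cat_tuple (in_tuple J) (in_tuple J').

Definition tuple_act (w : weyl) (t : tuples) : tuples := map_tuple (wact w) t.

Definition tableau (w : weyl) : tuples := tuple_act w Jbar.

Definition row_equiv (t1 t2 : tuples) : bool :=
  [exists w1 : weyl, exists w2 : weyl,
    [&& t1 == tableau w1, t2 == tableau w2 &
        [exists rho in conj_refl_group Psi w1, t2 == tuple_act rho t1]]].

Definition tabloid_set (w : weyl) : {set tuples} :=
  [set t | row_equiv (tableau w) t].

Definition tabloid_sets : {set {set tuples}} :=
  [set tabloid_set w | w : weyl].

Lemma tabloid_set_mem (w : weyl) :
  tabloid_set w \in tabloid_sets.
Proof. exact: imset_f. Qed.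

Definition tabloid : finType :=
  {A : {set tuples} | A \in tabloid_sets}.

Definition tabloid_of (w : weyl) : tabloid :=
  exist (fun A => A \in tabloid_sets) _ (tabloid_set_mem w).

Lemma tuple_actM (v w : weyl) (t : tuples) :
  tuple_act (v * w)%g t = tuple_act w (tuple_act v t).
Proof. by apply/val_inj; rewrite /= -map_comp; apply: eq_map => a; exact: wactM. Qed.

Lemma tuple_actK (w : weyl) : cancel (tuple_act w) (tuple_act w^-1%g).
Proof.
move=> t; rewrite -tuple_actM mulgV; apply/val_inj => /=.
by rewrite -[RHS]map_id; apply: eq_map => a; rewrite /wact perm1.
Qed.

Lemma row_equiv_act (w : weyl) (t1 t2 : tuples) :
  row_equiv t1 t2 -> row_equiv (tuple_act w t1) (tuple_act w t2).
Proof.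
move=> /existsP[w1 /existsP[w2 /and3P[/eqP t1E /eqP t2E]]].
move=> /existsP[rho /andP[rhoW /eqP t2rho]].
apply/existsP; exists (w1 * w)%g; apply/existsP; exists (w2 * w)%g.
rewrite t1E {1}t2E /tableau !tuple_actM !eqxx /=.
apply/existsP; exists (rho ^ w)%g; rewrite conjsgM memJ_conjg rhoW /=.
by rewrite t2rho t1E -!tuple_actM conjgE !mulgA mulgK.
Qed.

Lemma tabloid_setM (s w : weyl) :
  [set tuple_act s t | t in tabloid_set w] = tabloid_set (w * s)%g.
Proof.
apply/setP => t; apply/imsetP/idP => [[u + ->]|]; rewrite !inE => h.
  by rewrite /tableau tuple_actM row_equiv_act.
exists (tuple_act s^-1%g t); last first.
  by rewrite -{1}[s]invgK tuple_actK.
by rewrite inE -[tableau w](tuple_actK s) row_equiv_act// -tuple_actM.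
Qed.

Lemma tabloid_act_subproof (s : weyl) (t : tabloid) :
  [set tuple_act s x | x in val t] \in tabloid_sets.
Proof. by case: t => _ /= /imsetP[w _ ->]; rewrite tabloid_setM imset_f. Qed.

Definition tabloid_act (s : weyl) (t : tabloid) : tabloid :=
  exist (fun A => A \in tabloid_sets) _ (tabloid_act_subproof s t).

Lemma tabloid_act_of (s w : weyl) :
  tabloid_act s (tabloid_of w) = tabloid_of (w * s)%g.
Proof. by apply/val_inj; rewrite /= tabloid_setM. Qed.

Section Module.
Variable K : fieldType.

Definition tabloid_mod : vectType K := {ffun tabloid -> K^o}.

Definition tabloid_vec (t : tabloid) : tabloid_mod :=
  [ffun t' => (t' == t)%:R].

Definition tabloid_mod_act (s : weyl) (x : tabloid_mod) : tabloid_mod :=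
  \sum_(t : tabloid) x t *: tabloid_vec (tabloid_act s t).

Definition KW_submodule (U : {vspace tabloid_mod}) : Prop :=
  forall (s : weyl) (x : tabloid_mod), x \in U -> tabloid_mod_act s x \in U.

Definition tabloid_form (x y : tabloid_mod) : K := \sum_(t : tabloid) x t * y t.

Lemma tabloid_form_vec (t1 t2 : tabloid) :
  tabloid_form (tabloid_vec t1) (tabloid_vec t2) = (t1 == t2)%:R.
Proof.
rewrite /tabloid_form (bigD1 t1)//= big1 => [|t /negPf tt1].
  by rewrite !ffunE eqxx mul1r addr0.
by rewrite !ffunE tt1 mul0r.
Qed.

Lemma tabloid_form_bilinear :
  bilinear_for ( *%R : K -> K^o -> K^o) ( *%R : K -> K^o -> K^o) tabloid_form.
Proof.
split=> z a x y /=; rewrite /tabloid_form mulr_sumr -big_split /=;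
  apply: eq_bigr => t _; rewrite !ffunE.
  by rewrite mulrDl -mulrA.
by rewrite mulrDr mulrCA.
Qed.

Lemma tabloid_form_sym (x y : tabloid_mod) :
  tabloid_form x y = (-1) ^+ false * tabloid_form y x.
Proof. by rewrite mul1r; apply: eq_bigr => t _; rewrite mulrC. Qed.

HB.instance Definition _ := bilinear_isBilinear.Build K tabloid_mod tabloid_mod
  K^o ( *%R) (idfun \; *%R) tabloid_form tabloid_form_bilinear.

HB.instance Definition _ := isHermitianSesquilinear.Build K tabloid_mod
  false idfun tabloid_form tabloid_form_sym.

Definition tabloid_orth (S : {vspace tabloid_mod}) : {vspace tabloid_mod} :=
  orthov (tabloid_form : {symmetric tabloid_mod}) S.

Definition kappa (w : weyl) (x : tabloid_mod) : tabloid_mod :=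
  \sum_(s in conj_refl_group Psi' w) sign pi K s *: tabloid_mod_act s x.

(* This is e_{wJ,wJ'} = kappa_{wJ'} {w Jbar}; w = 1 gives e_{J,J'}. *)
Definition polytabloid (w : weyl) : tabloid_mod :=
  kappa w (tabloid_vec (tabloid_of w)).

Definition specht : {vspace tabloid_mod} :=
  <<[seq polytabloid w | w : weyl]>>%VS.

Definition D_Psi : {set weyl} :=
  [set w | all (fun j => wact w j \in positive_system pi) J].

Definition good_system : Prop :=
  useful_system pi Psi J Psi' J' /\
  forall d : weyl, d \in D_Psi ->
    [set wact d a | a in Psi] :&: Psi' = set0 ->
    polytabloid 1%g (tabloid_of d) != 0.

End Module.
End Tabloids.
End WeylGroup.
End RootSystems.

(* Main.v *)
(* Write kappa for the signed sum over W(J') and e for the polytabloid of      *)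
(* {J, J'}. The key point is that kappa maps M into the line K e. Indeed,      *)
(* moving w within its coset w W(J), which does not change the tabloid, one    *)
(* reaches some d in D_Psi. If d Psi meets Psi' in a root, its reflection is   *)
(* odd and fixes {d Jbar}, so kappa {d Jbar} = 0; otherwise {d Jbar} =         *)
(* s {Jbar} for some s in W(J') because the system is good, so                 *)
(* kappa {d Jbar} = sign(s) e. Hence either kappa x is a nonzero multiple of e *)
(* for some x in U, and U contains e and its translates, or kappa kills U, and *)
(* U is orthogonal to e and its translates since kappa is self-adjoint.        *)
Require Import Defs.
From HB Require Import structures.
From mathcomp Require Import all_boot all_order all_algebra all_fingroup.
From mathcomp Require Import sesquilinear finmap boolp reals.

Set Implicit Arguments.
Unset Strict Implicit.
Unset Printing Implicit Defensive.

Import Order.TTheory GRing.Theory Num.Theory.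

Local Open Scope ring_scope.

(** The sketch above rests on three facts. The sign is a character, being the parity of the
    permutation of the roots ([odd_weyl_tau], [signE]). Every tabloid has a representative in
    [D_Psi] ([coset_D_Psi]), whence the two cases of [tabloid_fixed_or_orbit]. The rest holds in any
    permutation module with these two cases ([submodule_dichotomy]). *)

(** * Parity of a permutation commuting with a negation *)

Lemma odd_card_involution (T : finType) (f : T -> T) (A : {set T}) :
    {in A, forall x, f x \in A} -> {in A, forall x, f (f x) = x} ->
  odd #|A| = odd #|[set x in A | f x == x]|.
Proof.
elim: {A}_.+1 {-2}A (ltnSn #|A|) => // n IH A; rewrite ltnS => An fA fK.
have [/subsetP Afix|/subsetPn[x xA]] := boolP (A \subset [set x | f x == x]).
  congr (odd #|pred_of_set _|); apply/setP => x; rewrite inE.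
  by case xA: (x \in A) => //=; have := Afix _ xA; rewrite inE.
rewrite inE => fxx.
have fxA : f x \in A :\ x by rewrite !inE fxx fA.
pose B := A :\ x :\ f x.
have cardA : #|A| = #|B|.+2 by rewrite (cardsD1 x A) xA (cardsD1 (f x)) fxA.
have fB : {in B, forall y, f y \in B}.
  move=> y; rewrite !inE => /and3P[yfx yx yA]; rewrite fA// andbT.
  apply/andP; split; first by apply: contra_neq yx => e; rewrite -(fK y)// e fK.
  by apply: contra_neq yfx => e; rewrite -(fK y)// e.
rewrite cardA /= negbK (IH B) ?fB//; last 2 first.
- by apply: leq_trans An; rewrite cardA ltnS leqnSn.
- by move=> y; rewrite !inE => /and3P[_ _]; apply: fK.
congr (odd #|pred_of_set _|); apply/setP => y; rewrite !inE.
have [->|yx] := eqVneq y x; first by rewrite (negPf fxx) !andbF.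
have [->|//] := eqVneq y (f x).
by rewrite fK// (eq_sym x) (negPf fxx) !andbF.
Qed.

(* Negation is an involution both of the points and of the s-orbits: it has no *)
(* fixed point, and its only fixed orbit is {x0, s x0}.                        *)
Lemma odd_perm_involution (T : finType) (s : {perm T}) (neg : T -> T) (x0 : T) :
    involutive s -> involutive neg -> (forall x, neg x != x) ->
    (forall x, neg (s x) = s (neg x)) -> s x0 = neg x0 ->
    (forall x, s x = neg x -> x \in [set x0; neg x0]) ->
  odd_perm s.
Proof.
move=> sK negK neg_neq negs sx0 only.
have orbE x : porbit s x = [set x; s x].
  apply/setP => y; apply/porbitP/set2P => [[i ->]|[]->]; last 2 first.
  - by exists 0; rewrite expg0 perm1.
  - by exists 1%N; rewrite expg1.
  elim: i => [|i [] IH]; first by rewrite expg0 perm1; left.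
    by rewrite expgSr permM IH; right.
  by rewrite expgSr permM IH sK; left.
have negorb x : neg @: [set x; s x] = porbit s (neg x).
  by rewrite imsetU1 imset_set1 negs orbE.
(* The parity of s is that of the number of points plus the number of orbits; [neg] shows the first
   even and the second odd. *)
rewrite /odd_perm -cardsT (@odd_card_involution _ neg)//.
rewrite (_ : [set x in setT | _] = set0) ?cards0/=; last first.
  by apply/setP => x; rewrite !inE (negPf (neg_neq x)).
rewrite (@odd_card_involution _ (fun O : {set T} => neg @: O)); last 2 first.
- by move=> _ /imsetP[x _ ->]; rewrite orbE negorb imset_f.
- move=> _ /imsetP[x _ ->]; rewrite -imset_comp -[RHS]imset_id.
  by apply: eq_imset => y /=; rewrite negK.
rewrite (_ : [set x in _ | _] = [set porbit s x0]) ?cards1//.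
apply/setP => O; rewrite !inE; apply/andP/eqP => [[/imsetP[x _ ->]]|->].
  rewrite {1}orbE negorb eq_porbit_mem orbE => /set2P[/eqP|/esym/only].
    by rewrite (negPf (neg_neq x)).
  by rewrite -sx0 -!orbE -eq_porbit_mem => /eqP.
split; first exact: imset_f.
by rewrite {1}orbE negorb eq_porbit_mem -sx0 orbE set22.
Qed.

(** * Weyl group elements as isometries, and their parity *)

Section WeylGroup.
Variables (R : realType) (V : vectType R) (dot : {dot V for idfun}).
Variable Phi : rootSystem dot.

(** Coordinates are given, not just a vector, because [coset_D_Psi] moves the vector by moving the
    roots. *)
Lemma dual_vector (B : seq Phi) (g : Phi -> R) :
    free [seq val b | b <- B] ->
  exists x : Phi -> R, {in B, forall b,
    dot (\sum_(c <- B) x c *: val c) (val b) = g b}.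
Proof.
move=> freeB; have uniqB : uniq B by rewrite (map_uniq (free_uniq freeB)).
(* The Gram matrix of a free family is invertible. *)
pose X := map_tuple val (in_tuple B).
pose G := \matrix_(i < size B, j < size B) dot X`_i X`_j.
have sumX (v : 'rV_(size B)) j :
    (v *m G) 0 j = dot (\sum_i v 0 i *: X`_i) X`_j.
  rewrite mxE linear_sumlz; apply: eq_bigr => i _.
  by rewrite mxE linearZl_LR.
have Gunit : G \in unitmx.
  rewrite -row_free_unit; apply/inj_row_free => v vG.
  have : dot (\sum_i v 0 i *: X`_i) (\sum_i v 0 i *: X`_i) = 0.
    by rewrite linear_sumr big1// => j _; rewrite linearZ/= -sumX vG mxE mulr0.
  move=> dot0; apply/rowP => i; rewrite mxE.
  move: i; apply: (@freeP _ _ _ X freeB (fun i => v 0 i)).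
  by apply/eqP; apply: contra_eqT dot0; exact: dot_neq0.
pose v := (\row_i g (tnth (in_tuple B) i)) *m invmx G.
have Bidx (i : 'I_(size B)) : index (tnth (in_tuple B) i) B = i.
  by rewrite (tnth_nth (tnth (in_tuple B) i)) index_uniq.
exists (fun c => if insub (index c B) is Some i then v 0 i else 0) => b bB.
have bB' : (index b B < size B)%N by rewrite index_mem.
have -> : b = tnth (in_tuple B) (Ordinal bB') by rewrite (tnth_nth b) nth_index.
rewrite big_tnth; set i := Ordinal bB'.
have XE j : val (tnth (in_tuple B) j) = X`_j by rewrite -tnth_nth tnth_map.
under eq_bigr do rewrite Bidx valK XE.
by rewrite XE -sumX mulmxKV// mxE.
Qed.

Lemma cartan_reflection (f : 'End(V)) (a x : V) :
    (forall u v, dot (f u) (f v) = dot u v) ->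
  f (reflection dot a x) = reflection dot (f a) (f x).
Proof. by move=> fdot; rewrite /reflection linearB linearZ /cartan !fdot. Qed.

Lemma weyl_ind (P : weyl Phi -> Prop) :
    P 1%g -> (forall w a, P w -> P (w * tau a)%g) ->
  forall w, P w.
Proof.
move=> P1 PM w; rewrite -[w]sgvalK.
have /gen_prodgP[n [c cT ->]] := subgP w.
elim: n c cT => [|n IH] c cT; first by rewrite big_ord0 morph1.
have /imsetP[a _ ca] := cT ord_max.
rewrite big_ord_recr /= ca subgM ?tau_weyl_group//; last first.
  by apply: group_prod => i _; apply: mem_gen.
by apply: PM; apply: IH.
Qed.

Lemma weylP (v w : weyl Phi) : (forall a, wact v a = wact w a) -> v = w.
Proof. by move=> vw; apply/val_inj/permP. Qed.

Lemma wact1 (a : Phi) : wact 1%g a = a.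
Proof. by rewrite /wact perm1. Qed.

Lemma wactVK (w : weyl Phi) : cancel (wact w^-1%g) (wact w).
Proof. by move=> a; rewrite -wactM mulVg wact1. Qed.

(** Elements of [weyl] are mere permutations of the roots; composing reflections recovers the
    underlying isometry. *)
Lemma wact_linear (w : weyl Phi) :
  exists2 f : 'End(V), forall a, val (wact w a) = f (val a)
                     & forall u v, dot (f u) (f v) = dot u v.
Proof.
elim/weyl_ind: w => [|w a [f fE fdot]].
  by exists \1%VF => [a|u v]; rewrite ?wact1 !id_lfunE.
have refl_lin : linear (reflection dot (val a)).
  move=> c u v; rewrite /reflection /cartan linearPl mulrDr mulrDl scalerDl.
  rewrite opprD addrACA; congr (_ + _); rewrite scalerBr scalerA; congr (_ - _ *: _).
  by rewrite [2 * _]mulrCA !mulrA.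
pose r : {linear V -> V} := HB.pack (reflection dot (val a))
  (GRing.isLinear.Build _ _ _ _ _ refl_lin).
have rE u : linfun r u = reflection dot (val a) u by rewrite lfunE.
exists (linfun r \o f)%VF => [b|u v].
  by rewrite wactM wact_tau fE comp_lfunE rE.
by rewrite !comp_lfunE !rE dot_reflection ?root_neq0// reflectionK ?root_neq0.
Qed.

Lemma tauJ (a : Phi) (w : weyl Phi) : (tau a ^ w)%g = tau (wact w a).
Proof.
apply: weylP => b; rewrite conjgE mulgA !wactM -{2}[b](wactVK w).
have [f fE fdot] := wact_linear w; apply: val_inj.
by rewrite !(fE, wact_tau) cartan_reflection.
Qed.

Definition root_opp (a : Phi) : Phi := wact (tau a) a.

Lemma val_root_opp (a : Phi) : val (root_opp a) = - val a.
Proof.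
rewrite wact_tau /reflection cartan_id ?root_neq0//.
by rewrite scaler_nat mulr2n opprD addrA subrr add0r.
Qed.

Lemma tau_root_opp (a : Phi) : tau (root_opp a) = tau a.
Proof. by rewrite /root_opp -tauJ conjgE mulKg. Qed.

Lemma tauK (a : Phi) : involutive (wact (tau a)).
Proof. by move=> b; apply: val_inj; rewrite !wact_tau reflectionK ?root_neq0. Qed.

Lemma root_parallel (a b : Phi) (c : R) :
  val b = c *: val a -> b = a \/ b = root_opp a.
Proof.
move=> bE; have [_ _ _ red] := rootsP Phi.
have [||c1|c1] := red (val a) _ c; rewrite -?bE; try exact: valP.
  by left; apply: val_inj; rewrite bE c1 scale1r.
by right; apply: val_inj; rewrite bE c1 scaleN1r val_root_opp.
Qed.

(* Every reflection is an odd permutation of the roots, so the parity of any   *)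
(* word in the reflections representing w is that of the permutation w.        *)
Definition odd_weyl (w : weyl Phi) : bool := odd_perm (sgval w).

Lemma odd_weyl1 : odd_weyl 1%g = false.
Proof. by rewrite /odd_weyl morph1 odd_perm1. Qed.

Lemma odd_weylM (v w : weyl Phi) : odd_weyl (v * w)%g = odd_weyl v (+) odd_weyl w.
Proof. by rewrite /odd_weyl morphM ?inE// odd_permM. Qed.

(** A root b sent to its opposite satisfies 2b = c a, so it is a or its opposite since [Phi] is
    reduced. *)
Lemma odd_weyl_tau (a : Phi) : odd_weyl (tau a).
Proof.
apply: (@odd_perm_involution _ _ root_opp a).
- exact: tauK.
- by move=> b; apply: val_inj; rewrite !val_root_opp opprK.
- move=> b; apply/negP => /eqP/(congr1 val); rewrite val_root_opp => /eqP.
  by rewrite eq_sym -addr_eq0 -mulr2n -scaler_nat scaler_eq0 pnatr_eq0/=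
    (negPf (root_neq0 b)).
- move=> b; have [f fE _] := wact_linear (tau a); apply: val_inj.
  by rewrite val_root_opp -!/(wact _ _) !fE val_root_opp linearN.
- by [].
move=> b /(congr1 val); rewrite -/(wact _ _) val_root_opp wact_tau /reflection => /eqP.
rewrite subr_eq addrC -subr_eq opprK -mulr2n -scaler_nat => /eqP b2.
have : val b = (2^-1 * cartan dot (val a) (val b)) *: val a.
  by rewrite -scalerA -b2 scalerA mulVf ?pnatr_eq0// scale1r.
by move=> /root_parallel[]->; rewrite !inE eqxx ?orbT.
Qed.

Lemma nonneg_comb_dot_ge0 (B : seq Phi) (u v : V) :
    {in B, forall b, 0 <= dot u (val b)} -> nonneg_comb B v -> 0 <= dot u v.
Proof.
move=> uB [c c0 ->]; rewrite linear_sumr big_seq sumr_ge0// => b bB.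
by rewrite linearZ/= mulr_ge0 ?c0 ?uB.
Qed.

(** For g constantly 1 this yields the height; for g an indicator, a coordinate. *)
Lemma dual_functional (Psi : {set Phi}) (B : seq Phi) (g : Phi -> R) :
  simple_system Psi B -> exists u, {in B, forall b, dot u (val b) = g b}.
Proof.
by move=> [_ freeB _]; have [x xB] := dual_vector g freeB; eexists; exact: xB.
Qed.

Lemma simple_uniq (Psi : {set Phi}) (B : seq Phi) : simple_system Psi B -> uniq B.
Proof. by move=> [_ freeB _]; rewrite (map_uniq (free_uniq freeB)). Qed.

(** * Positive roots, generation by simple reflections, coset representatives *)

Section SimpleSystem.
Variable pi : seq Phi.
Hypothesis pi_simple : simple_system [set: Phi] pi.

Lemma positive_systemP (a : Phi) :
  reflect (nonneg_comb pi (val a)) (a \in positive_system pi).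
Proof. by rewrite inE; apply: asboolP. Qed.

Lemma positive_or_opp (a : Phi) :
  a \in positive_system pi \/ root_opp a \in positive_system pi.
Proof.
have [_ _ /(_ a)[|pa|pa]] := pi_simple; first by rewrite inE.
  by left; apply/positive_systemP.
by right; apply/positive_systemP; rewrite val_root_opp.
Qed.

Lemma dot_ge0_positive (u : V) (a : Phi) :
    {in pi, forall b, dot u (val b) = 1} -> 0 <= dot u (val a) ->
  a \in positive_system pi.
Proof.
move=> u1 ua; have [//|/positive_systemP[c c0]] := positive_or_opp a.
rewrite val_root_opp => aE; exfalso; move/eqP: (root_neq0 a); apply.
have : \sum_(b <- pi) c b == 0.
  rewrite eq_le big_seq sumr_ge0// andbT -oppr_ge0; move: ua.
  rewrite -[val a]opprK aE linearNr linear_sumr big_seq /=; congr (0 <= - _).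
  by apply: eq_bigr => b bpi; rewrite linearZ/= u1// mulr1.
rewrite big_seq psumr_eq0// => /allP c_eq0.
rewrite -[val a]opprK aE big_seq big1 ?oppr0// => b bpi.
by have := c_eq0 b bpi; rewrite bpi => /eqP->; rewrite scale0r.
Qed.

(** The reflection changes only the b-coordinate. If the image were negative, the other coordinates
    of a would vanish, making a parallel to b. *)
Lemma tau_simple_positive (a b : Phi) :
    b \in pi -> a \in positive_system pi -> a != b ->
  wact (tau b) a \in positive_system pi.
Proof.
move=> bpi /positive_systemP[c c0 aE] ab.
have [//|/positive_systemP] := positive_or_opp (wact (tau b) a).
rewrite val_root_opp wact_tau => neg; exfalso.
have dotc u : dot u (val a) = \sum_(b' <- pi) c b' * dot u (val b').
  by rewrite aE linear_sumr; apply: eq_bigr => b' _; rewrite linearZ.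
have dual b' : exists2 u, {in pi, forall d, dot u (val d) = (d == b')%:R}
    & b' \in pi -> dot u (val a) = c b'.
  have [u ub'] := dual_functional (fun d => (d == b')%:R) pi_simple.
  exists u => // b'pi; rewrite dotc (bigD1_seq b')//= ?(simple_uniq pi_simple)//.
  rewrite ub'// eqxx mulr1 big_seq_cond big1 ?addr0// => d /andP[dpi db'].
  by rewrite ub'// (negPf db') mulr0.
have c_eq0 b' : b' \in pi -> b' != b -> c b' = 0.
  move=> b'pi b'b; have [u udual uc] := dual b'.
  apply/eqP; rewrite eq_le c0// andbT -uc// -oppr_ge0.
  have : {in pi, forall d, 0 <= dot u (val d)}.
    by move=> d dpi; rewrite udual//; exact: ler0n.
  move=> /nonneg_comb_dot_ge0/(_ neg); rewrite /reflection opprB linearBr linearZ/=.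
  by rewrite udual// eq_sym (negPf b'b) mulr0 sub0r.
have : val a = c b *: val b.
  rewrite aE (bigD1_seq b)//= ?(simple_uniq pi_simple)//.
  rewrite big_seq_cond big1 ?addr0// => d /andP[dpi db].
  by rewrite c_eq0// scale0r.
case/root_parallel => ae; first by rewrite ae eqxx in ab.
have [u udual uc] := dual b; have := c0 b bpi.
have -> : c b = - dot u (val b) by rewrite -uc// ae val_root_opp linearNr.
by rewrite udual// eqxx oppr_ge0 ler10.
Qed.

Definition simple_refl_group : {group weyl Phi} := <<[set tau a | a in pi]>>%G.

(* Among the positive roots of the orbit, one of least height is simple. *)
Lemma positive_conj_simple (a : Phi) : a \in positive_system pi ->
  exists2 w, w \in simple_refl_group & wact w a \in pi.
Proof.
move=> apos; have [u u1] := dual_functional (fun=> 1) pi_simple.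
pose P w := (w \in simple_refl_group) && (wact w a \in positive_system pi).
have P1 : P 1%g by rewrite /P group1 wact1.
case: (arg_minP (fun w => dot u (val (wact w a))) P1) => w /andP[wG wpos] wmin.
exists w => //; apply/negPn/negP => wa.
move/positive_systemP: (wpos) => [c c0 waE].
(* If not simple, this root stays positive under each simple reflection, so minimality makes its
   product with every simple root nonpositive; being their nonnegative combination, it has norm at
   most 0. *)
suff : dot (val (wact w a)) (val (wact w a)) <= 0.
  by apply/negP; rewrite -ltNge neq0_dnorm_gt0 ?root_neq0.
rewrite {2}waE linear_sumr big_seq sumr_le0// => b bpi.
rewrite linearZ/= mulr_ge0_le0 ?c0// leNgt; apply/negP => dot_gt0.
have wab : wact w a != b by apply: contraNneq wa => ->.
have := wmin (w * tau b)%g; rewrite /P groupM ?wactM ?tau_simple_positive//; last first.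
  by rewrite mem_gen ?imset_f.
move=> /(_ isT); rewrite wact_tau /reflection linearBr linearZ/= (u1 b)// mulr1.
rewrite leNgt ltrBlDr ltrDl => /negP; apply.
by rewrite /cartan divr_gt0 ?mulr_gt0 ?neq0_dnorm_gt0 ?root_neq0.
Qed.

Lemma simple_refl_group_full (w : weyl Phi) : w \in simple_refl_group.
Proof.
elim/weyl_ind: w => [|w a wG]; first exact: group1.
rewrite groupM//; wlog apos : a / a \in positive_system pi.
  by move=> h; have [/h//|/h] := positive_or_opp a; rewrite tau_root_opp.
have [v vG vpi] := positive_conj_simple apos.
by rewrite -(groupJr _ vG) tauJ mem_gen ?imset_f.
Qed.

(** A product of k simple reflections has the parity of k; [simple_refl_group_full] rules out the
    default value of [length]. *)
Lemma signE (K : fieldType) (w : weyl Phi) : sign pi K w = (-1) ^+ odd_weyl w.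
Proof.
set S := [set tau a | a in pi].
have exprS k v : v \in (S ^+ k)%g -> odd k = odd_weyl v.
  elim: k v => [|k IH] v; first by rewrite expg0 inE => /eqP->; rewrite odd_weyl1.
  rewrite expgSr => /mulsgP[x _ /IH kx /imsetP[a _ ->] ->].
  by rewrite odd_weylM odd_weyl_tau -kx addbT.
rewrite /sign /length; case: pselect => [wS|[]].
  by case: ex_minnP => k /exprS <- _; rewrite signr_odd.
have /gen_prodgP[n [c cS ->]] := simple_refl_group_full w.
exists n; rewrite -[n in (_ ^+ n)%g]card_ord -prodg_const; exact: mem_prodg.
Qed.

Lemma coset_D_Psi (Psi : {set Phi}) (J : seq Phi) (w : weyl Phi) :
    simple_system Psi J ->
  exists2 r, r \in refl_group Psi & (r * w)%g \in D_Psi pi J.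
Proof.
move=> Jsimple; have [JPsi freeJ _] := Jsimple.
have [u u1] := dual_functional (fun=> 1) pi_simple.
have [x xJ] := dual_vector (fun=> 1) freeJ.
(* A product r w of maximal height on a vector pairing to 1 with each root of *)
(* J lies in D_Psi: otherwise some tau j, j in J, would increase the height.  *)
pose height r := dot u (\sum_(c <- J) x c *: val (wact (r * w)%g c)).
case: (arg_maxP height (group1 (refl_group Psi))) => r rG rmax.
exists r => //; rewrite inE; apply/allP => j jJ.
apply: (dot_ge0_positive u1).
have jG : tau j \in refl_group Psi by rewrite mem_gen// imset_f ?JPsi.
have := rmax (tau j * r)%g (groupM jG rG); rewrite /height.
have [f fE _] := wact_linear (r * w)%g.
(* Inserting [tau j] subtracts a positive multiple of the image of j, whose height is thus
   nonnegative by maximality. *)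
have -> : \sum_(c <- J) x c *: val (wact (tau j * r * w)%g c) =
    f (\sum_(c <- J) x c *: val c) -
    cartan dot (val j) (\sum_(c <- J) x c *: val c) *: f (val j).
  rewrite linear_sum /cartan linear_sumlz mulr_sumr mulr_suml scaler_suml -sumrB.
  apply: eq_bigr => c _.
  have -> : val (wact (tau j * r * w)%g c) =
      f (val c) - cartan dot (val j) (val c) *: f (val j).
    by rewrite -mulgA wactM fE wact_tau /reflection linearB linearZ.
  rewrite scalerBr; congr (_ - _); first by rewrite [RHS]linearZ.
  rewrite scalerA linearZl_LR /cartan.
  by congr (_ *: _); rewrite [2 * (x c * _)]mulrCA !mulrA.
have -> : \sum_(c <- J) x c *: val (wact (r * w)%g c) =
    f (\sum_(c <- J) x c *: val c).
  by rewrite linear_sum; apply: eq_bigr => c _; rewrite linearZ fE.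
rewrite linearBr linearZ/= lerBlDr lerDl -fE pmulr_rge0//.
by rewrite /cartan xJ// mulr1 divr_gt0 ?neq0_dnorm_gt0 ?root_neq0.
Qed.
End SimpleSystem.
End WeylGroup.

(** * The submodule dichotomy in an abstract permutation module *)

(* For the theorem G is the Weyl group, T the set of tabloids, tab w is        *)
(* {w Jbar}, H is W(J'), and par is the parity behind sgn; the group is kept   *)
(* abstract so that conversion cannot unfold the concrete tabloids.            *)
Section PermutationModule.
Variables (K : fieldType) (G : finGroupType) (T : finType).
Variables (act : G -> T -> T) (tab : G -> T).
Hypothesis act_tab : forall s w, act s (tab w) = tab (w * s)%g.
Hypothesis tabP : forall t, exists w, t = tab w.
Variables (par : G -> bool) (sgn : G -> K).
Hypothesis parM : {morph par : v w / (v * w)%g >-> v (+) w}.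
Hypothesis sgnE : forall s, sgn s = (-1) ^+ par s.
Variable H : {group G}.

(** The bodies copy those of the tabloid module, so that results transfer by conversion. *)
Definition perm_mod : vectType K := {ffun T -> K^o}.
Local Notation M := perm_mod.
Definition perm_vec (t : T) : M := [ffun t' => (t' == t)%:R].
Local Notation vec := perm_vec.
Definition perm_act (s : G) (x : M) : M := \sum_(t : T) x t *: vec (act s t).
Local Notation mact := perm_act.
Definition perm_form (x y : M) : K := \sum_(t : T) x t * y t.
Local Notation form := perm_form.
Definition perm_kappa (w : G) (x : M) : M :=
  \sum_(s in (H :^ w)%G) sgn s *: mact s x.
Local Notation kap := perm_kappa.
Definition perm_pol (w : G) : M := kap w (vec (tab w)).
Local Notation pol := perm_pol.

Let actM v w t : act (v * w)%g t = act w (act v t).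
Proof. by have [x ->] := tabP t; rewrite !act_tab mulgA. Qed.

Let actK w : cancel (act w) (act w^-1%g).
Proof.
by move=> t; rewrite -actM mulgV; have [x ->] := tabP t; rewrite act_tab mulg1.
Qed.

Let actVK w : cancel (act w^-1%g) (act w).
Proof. by move=> t; rewrite -{1}[w]invgK actK. Qed.

Let sgnM v w : sgn (v * w)%g = sgn v * sgn w.
Proof. by rewrite !sgnE parM signr_addb. Qed.

Let sgnV w : sgn w^-1%g = sgn w.
Proof.
rewrite !sgnE; have := parM w w^-1%g; have := parM 1%g 1%g.
by rewrite mulgV mulg1; case: (par 1%g) (par w) (par w^-1%g) => [] [] [].
Qed.

Let vecE t u : vec t u = (u == t)%:R.
Proof. by rewrite ffunE. Qed.

Let mactE s x t : mact s x t = x (act s^-1%g t).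
Proof.
rewrite /perm_act sum_ffunE (bigD1 (act s^-1%g t))//= big1 => [|u ut].
  by rewrite addr0 !ffunE actVK eqxx [_ *: _]mulr1.
rewrite !ffunE; case: eqP => [tE|_]; last by rewrite scaler0.
by rewrite tE actK eqxx in ut.
Qed.

Let mact_vec s t : mact s (vec t) = vec (act s t).
Proof.
apply/ffunP => u; rewrite mactE !vecE; congr (_%:R); congr nat_of_bool.
by apply/eqP/eqP => [<-|->]; rewrite ?actVK ?actK.
Qed.

Let kapE w x t : kap w x t = \sum_(s in (H :^ w)%G) sgn s * x (act s^-1%g t).
Proof.
by rewrite /perm_kappa sum_ffunE; apply: eq_bigr => s _; rewrite ffunE mactE.
Qed.

Let kap1E x t : kap 1%g x t = \sum_(s in H) sgn s * x (act s^-1%g t).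
Proof. by rewrite kapE; apply: eq_bigl => s; rewrite /= conjsg1. Qed.

Let polE w : pol w = mact w (pol 1%g).
Proof.
rewrite /perm_pol -[w in vec (tab w)]mul1g -act_tab -mact_vec.
apply/ffunP => t; rewrite kapE mactE kap1E (reindex_inj (conjg_inj w)).
apply: eq_big => [s|s _]; first by rewrite /= memJ_conjg.
congr (_ * _); last first.
  by rewrite mactE -!actM conjgE !invMg invgK mulgK.
by rewrite conjgE !sgnM sgnV mulrCA [sgn w]sgnE -expr2 sqrr_sign mulr1.
Qed.

Let kap_shift s x : s \in H -> kap 1%g (mact s x) = sgn s *: kap 1%g x.
Proof.
move=> sH; apply/ffunP => t; rewrite ffunE !kap1E scaler_sumr.
rewrite (reindex_inj (mulgI s^-1%g)); apply: eq_big => [z|z _].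
  by rewrite groupMl ?groupV.
by rewrite mactE -actM invMg invgK mulgK sgnM sgnV -mulrA.
Qed.

(* The even and odd parts of kappa are exchanged by an odd element fixing x,  *)
(* so they cancel even in characteristic 2.                                   *)
Let kap_fixed r x : r \in H -> par r -> mact r x = x -> kap 1%g x = 0.
Proof.
move=> rH rodd rx; apply/ffunP => t; rewrite kap1E ffunE (bigID par) /=.
rewrite (reindex_inj (mulgI r)) /=.
rewrite (eq_bigl (fun s => (s \in H) && ~~ par s)); last first.
  by move=> s; rewrite groupMl// parM rodd.
rewrite -big_split big1//= => s _.
rewrite sgnM invMg actM -[x (act r^-1%g _)]mactE rx.
by rewrite sgnE rodd expr1 mulN1r mulNr addNr.
Qed.

Lemma perm_kappa_supp t : kap 1%g (vec (tab 1%g)) t != 0 ->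
  exists2 s, s \in H & t = act s (tab 1%g).
Proof.
rewrite kap1E => et; have [s /andP[sH /eqP]|none] := pickP
  (fun s => (s \in H) && (t == act s (tab 1%g))).
  by exists s.
case/eqP: et; apply: big1 => s sH; rewrite vecE.
have := none s; rewrite sH /= => ts; case: eqP => [tE|_]; last by rewrite mulr0.
by rewrite -tE actVK eqxx in ts.
Qed.

Hypothesis fixed_or_orbit : forall t,
  (exists r, [/\ r \in H, par r & act r t = t]) \/
  exists2 s, s \in H & t = act s (tab 1%g).

Let kap_line x : kap 1%g x \in <[pol 1%g]>%VS.
Proof.
have -> : kap 1%g x = \sum_t x t *: kap 1%g (vec t).
  apply/ffunP => u; rewrite kap1E sum_ffunE.
  under [RHS]eq_bigr do rewrite ffunE kap1E scaler_sumr.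
  rewrite exchange_big; apply: eq_bigr => s _ /=.
  rewrite (bigD1 (act s^-1%g u))//= big1 => [|t tu].
    by rewrite addr0 vecE eqxx mulr1 [RHS]mulrC.
  by rewrite vecE eq_sym (negPf tu) mulr0 scaler0.
apply: memv_suml => t _; apply: memvZ.
have [[r [rH rodd rt]]|[s sH ->]] := fixed_or_orbit t.
  by rewrite (kap_fixed rH rodd) ?mem0v// mact_vec rt.
by rewrite -mact_vec kap_shift// memvZ ?memv_line.
Qed.

Let form_mact s x y : form (mact s x) y = form x (mact s^-1%g y).
Proof.
rewrite /perm_form (reindex_inj (can_inj (actK s))).
by apply: eq_bigr => t _; rewrite !mactE invgK actK.
Qed.

(** The adjoint of s is its inverse, which lies in H and has the same sign. *)
Let form_kap x y : form (kap 1%g x) y = form x (kap 1%g y).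
Proof.
transitivity (\sum_(s in H) sgn s * form (mact s x) y).
  rewrite /perm_form; under [RHS]eq_bigr do rewrite mulr_sumr.
  rewrite exchange_big; apply: eq_bigr => t _; rewrite kap1E mulr_suml.
  by apply: eq_bigr => s _; rewrite mactE mulrA.
rewrite (reindex_inj invg_inj) /perm_form.
under eq_bigr do rewrite -/(perm_form _ _) form_mact.
rewrite /perm_form; under eq_bigr do rewrite mulr_sumr.
rewrite exchange_big; apply: eq_bigr => t _; rewrite kap1E mulr_sumr.
apply: eq_big => [s|s _]; first by rewrite groupV.
by rewrite invgK mactE sgnV mulrCA.
Qed.

Lemma submodule_dichotomy (U : {vspace M}) :
    (forall s x, x \in U -> mact s x \in U) ->
  (forall w, pol w \in U) \/ {in U, forall x w, form x (pol w) = 0}.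
Proof.
move=> Ustable.
have [[x xU kx]|none] := pselect (exists2 x, x \in U & kap 1%g x != 0).
  left=> w; have /vlineP[c ke] := kap_line x; rewrite polE; apply: (Ustable).
  have c0 : c != 0 by apply: contraNneq kx => c0; rewrite ke c0 scale0r.
  rewrite -[pol _](scalerK c0) -ke memvZ// memv_suml// => s _.
  by apply: memvZ; apply: Ustable.
right=> x xU w.
(* Moving w and then kappa across the form puts kappa on the translate of x by the inverse of w. *)
have k0 : kap 1%g (mact w^-1%g x) = 0.
  apply/eqP/negPn/negP => k0; apply: none.
  by exists (mact w^-1%g x); [exact: Ustable|].
rewrite polE -[w]invgK -form_mact -form_kap k0.
by rewrite /perm_form big1// => t _; rewrite ffunE mul0r.
Qed.
End PermutationModule.

(** * Application to tabloids *)

Section Tabloids.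
Variables (R : realType) (V : vectType R) (dot : {dot V for idfun}).
Variables (Phi : rootSystem dot) (pi : seq Phi) (Psi : {set Phi}) (J : seq Phi).
Variables (Psi' : {set Phi}) (J' : seq Phi).
Hypothesis pi_simple : simple_system [set: Phi] pi.
Hypothesis J_simple : simple_system Psi J.

Local Notation tableau := (tableau J J').
Local Notation tabloid := (tabloid Psi J J').
Local Notation tabloid_of := (tabloid_of Psi J J').

(** [row_equiv] accepts any w1 giving the tableau, so W(w1 J) must depend on the tableau alone. It
    does, as the action is linear and J spans [Psi]. *)
Lemma tableau_agree (v w : weyl Phi) :
  tableau v = tableau w -> {in Psi, wact v =1 wact w}.
Proof.
have [_ _ Jspan] := J_simple; have [f fE _] := wact_linear v.
have [g gE _] := wact_linear w => /(congr1 val)/eq_in_map vw.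
have fgJ : {in J, forall j, f (val j) = g (val j)}.
  by move=> j jJ; rewrite -fE -gE vw// mem_cat jJ.
have fgcomb x : nonneg_comb J x -> f x = g x.
  case=> c _ ->; rewrite !linear_sum big_seq [RHS]big_seq.
  by apply: eq_bigr => j jJ; rewrite !linearZ/= fgJ.
move=> a aPsi; apply: val_inj; rewrite fE gE.
have [/fgcomb//|/fgcomb] := Jspan a aPsi.
by rewrite !linearN => /oppr_inj.
Qed.

Lemma conj_refl_group_agree (v w : weyl Phi) :
    {in Psi, wact v =1 wact w} ->
  conj_refl_group Psi v = conj_refl_group Psi w.
Proof.
move=> vw; apply: val_inj; rewrite /= -!genJ; congr <<_>>%g.
apply/setP => z; rewrite !mem_conjg.
have conj_tau y : (z ^ y^-1 \in [set tau a | a in Psi])%g =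
    (z \in [set tau (wact y a) | a in Psi]).
  apply/imsetP/imsetP => -[a aPsi za]; exists a => //.
    by rewrite -tauJ -za conjgKV.
  by rewrite za -tauJ conjgK.
rewrite !conj_tau; congr (_ \in pred_of_set _); apply: eq_in_imset => a aPsi.
by rewrite vw.
Qed.

(* This is {w r Jbar} = {w Jbar} for r in W(J). *)
Lemma tabloid_of_refl (r w : weyl Phi) :
  r \in refl_group Psi -> tabloid_of (r * w)%g = tabloid_of w.
Proof.
suff sub r' w' : r' \in refl_group Psi ->
    tabloid_set Psi J J' w' \subset tabloid_set Psi J J' (r' * w')%g.
  move=> rG; apply: val_inj; apply/eqP; rewrite eqEsubset (sub _ _ rG) andbT.
  have rVG : r^-1%g \in refl_group Psi by rewrite groupV.
  by have := sub _ (r * w)%g rVG; rewrite mulKg.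
move=> rG; apply/subsetP => t; rewrite 2!inE.
move=> /existsP[w1 /existsP[w2 /and3P[/eqP w1E /eqP t2E]]].
move=> /existsP[rho /andP[rhoG /eqP tE]].
apply/existsP; exists (r' * w')%g; apply/existsP; exists w2.
(* The first factor brings the new tableau back to that of w'; then rho leads to t. *)
rewrite eqxx t2E eqxx /=; apply/existsP; exists ((r' ^ w')^-1 * rho)%g.
have -> : tableau (r' * w')%g = tuple_act (r' ^ w')%g (tableau w').
  by rewrite /Defs.tableau conjgC tuple_actM.
rewrite tuple_actM tuple_actK -t2E -tE eqxx andbT.
have -> : (<<[set tau a | a in Psi]>> :^ (r' * w') = refl_group Psi :^ w')%g.
  by rewrite conjsgM (conjGid rG).
rewrite -(conj_refl_group_agree (tableau_agree w1E)) in rhoG.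
by apply: groupM => //; rewrite groupV memJ_conjg.
Qed.

Lemma tabloid_ofP (t : tabloid) : exists w, t = tabloid_of w.
Proof.
by case: t => A AP; have /imsetP[w _ AE] := AP; exists w; apply: val_inj.
Qed.

Local Notation act := (@tabloid_act _ _ _ _ Psi J J').

Lemma polytabloid_supp (K : fieldType) (t : tabloid) :
    polytabloid pi Psi J Psi' J' K 1%g t != 0 ->
  exists2 s, s \in refl_group Psi' & t = act s (tabloid_of 1%g).
Proof.
exact: (@perm_kappa_supp K _ _ act tabloid_of (@tabloid_act_of _ _ _ _ Psi J J')
  tabloid_ofP (sign pi K) (refl_group Psi') t).
Qed.

Lemma tabloid_fixed_or_orbit (K : fieldType) (t : tabloid) :
    good_system pi Psi J Psi' J' K ->
  (exists r, [/\ r \in refl_group Psi', odd_weyl r & act r t = t]) \/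
  exists2 s, s \in refl_group Psi' & t = act s (tabloid_of 1%g).
Proof.
move=> good; have [w ->] := tabloid_ofP t.
have [r rG rwD] := coset_D_Psi pi_simple w J_simple.
rewrite -(tabloid_of_refl w rG); move: rwD; set d := (r * w)%g => dD.
have [/eqP disj|/set0Pn[a]] := boolP ([set wact d a | a in Psi] :&: Psi' == set0).
  by right; exact: (polytabloid_supp (good.2 d dD disj)).
rewrite inE => /andP[/imsetP[b bPsi ->] bPsi']; left; exists (tau (wact d b)).
split; [by rewrite mem_gen ?imset_f | exact: odd_weyl_tau |].
(* Multiplying d by the reflection in d b gives [tau b * d], and [tau b] is in W(J). *)
rewrite tabloid_act_of -tauJ conjgE mulKVg.
by rewrite tabloid_of_refl// mem_gen ?imset_f.
Qed.

End Tabloids.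

Theorem theorem3p22 (R : realType) (V : vectType R) (dot : {dot V for idfun})
    (Phi : rootSystem dot) (pi : seq Phi) (Psi Psi' : {set Phi})
    (J J' : seq Phi) (K : fieldType) (U : {vspace tabloid_mod Psi J J' K}) :
  simple_system [set: Phi] pi ->
  good_system pi Psi J Psi' J' K ->
  KW_submodule U ->
  (specht pi Psi J Psi' J' K <= U)%VS \/
  (U <= tabloid_orth (specht pi Psi J Psi' J' K))%VS.
Proof.
move=> pi_simple good Usub; have Jsimple := useful_simple good.1.
have [|eU|ortho] := @submodule_dichotomy K _ _ _ _
  (@tabloid_act_of _ _ _ _ Psi J J') (@tabloid_ofP _ _ _ _ Psi J J')
  _ _ (@odd_weylM _ _ _ Phi) (signE pi_simple K) (refl_group Psi') _ U Usub.
- by move=> t; apply: tabloid_fixed_or_orbit good.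
- by left; apply/span_subvP => _ /mapP[w _ ->]; apply: eU.
(* By symmetry, orthogonality need only be checked on the polytabloids. *)
right; rewrite /tabloid_orth orthov_sym; apply/span_subvP => _ /mapP[w _ ->].
by apply/mem_orthovP => x xU /=; rewrite tabloid_form_sym mul1r; apply: ortho.
Qed.
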